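(* In the Cayley–Klein–Beltrami unit disk model of $\mathbb{H}^2$ let $A=(1,0,a)$ and $B=(1,b,0)$ (homogeneous coordinates, $a,b>1$) be outer points such that the line $AB$ intersects the model circle. Let $FCDEO$ be the associated doubly truncated orthoscheme, let $J$ be the midpoint of the segment $CD$, and let the two hypercycles with base lines $OE$ and $FC$ passing through $J$ generate the covering configuration $\mathcal{C}_{a,b}\left(\frac12\right)$ of $FCDEO$. Then $$\lim_{(a,b)\to(1,\infty)}\ \delta\left(\mathcal{C}_{a,b}\left(\tfrac12\right)\right)=\frac{\sqrt{12}}{\pi}.$$
   Context: Model. $\mathbb{H}^2$ is the open unit disk with homogeneous coordinates $(1,x,y)$, geodesics being Euclidean chords, with distance $\cosh d(p,q)=\frac{1-x_px_q-y_py_q}{\sqrt{(1-x_p^2-y_p^2)(1-x_q^2-y_q^2)}}$. The polar line of an outer point $(1,p,q)$, $p^2+q^2>1$, is $\{(x,y): px+qy=1\}$. Truncated orthoscheme. $O=(1,0,0)$ is the center of the disk. $F$ is the intersection of the polar line of $A$ with the line $OA$, i.e. $F=(1,0,\frac1a)$; $C$ is the intersection of the polar line of $A$ with the line $AB$; $D$ is the intersection of the polar line of $B$ with the line $AB$; $E$ is the intersection of the polar line of $B$ with the line $OB$, i.e. $E=(1,\frac1b,0)$. The condition that $AB$ intersects the model (passes through its interior) is $\frac1{a^2}+\frac1{b^2}>1$; the limit is taken over pairs $(a,b)$ satisfying this condition. $FCDEO$ is a hyperbolic pentagon with five right angles. The midpoint $J$ of $CD$ is taken in the model, $J=\frac12(C+D)$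 in coordinates with first coordinate $1$. Hypercycles and density. A hypercycle with base line $\ell$ and height $h$ is the set of points at distance $h$ from $\ell$. Let $h_1$ be the hyperbolic distance of $J$ from the line $OE$ and $h_2$ its hyperbolic distance from the line $FC$. Let $\mathcal{H}_1$ be the region, on the side of $OE$ containing the pentagon, bounded by the segment $OE$, the perpendiculars to $OE$ at $O$ and at $E$, and the hypercycle of height $h_1$ with base line $OE$; let $\mathcal{H}_2$ be the analogous region for the segment $FC$ and height $h_2$. Their areas are $|OE|\sinh h_1$ and $|FC|\sinh h_2$, where $|\cdot|$ is hyperbolic length. The density is $$\delta\left(\mathcal{C}_{a,b}\left(\tfrac12\right)\right)=\frac{Area(\mathcal{H}_1)+Area(\mathcal{H}_2)}{Area(FCDEO)}.$$
   Formalization: The joint limit over admissible (a,b)→(1,∞) does not exist (along 1/a²=1−1/(2b²) the density tends to about 1.262, not √12/π≈1.103), so the limit is stated as an iterated one: first a→1 for fixed b>1, then b→∞. *)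

(* Defs.v *)
From mathcomp Require Import all_boot all_order all_algebra.
From mathcomp Require Import all_classical all_reals all_analysis.
From mathcomp Require Import ring lra.
Import Order.TTheory GRing.Theory Num.Theory.
Import numFieldNormedType.Exports.
Set Implicit Arguments.
Unset Strict Implicit.
Unset Printing Implicit Defensive.
Local Open Scope classical_set_scope.
Local Open Scope ring_scope.

Section klein_model.
Context {R : realType}.

(* A vector (u0, u1, u2) of homogeneous coordinates is the triple ((u0, u1), u2);
   a point of the plane is the pair of its affine coordinates (x, y). *)
Definition hvec : Type := (R * R * R)%type.
Definition hom (p : R * R) : hvec := (1, p.1, p.2).
Definition affine (u : hvec) : R * R := (u.1.2 / u.1.1, u.2 / u.1.1).

Definition disk : set (R * R) := [set p | p.1 ^+ 2 + p.2 ^+ 2 < 1].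

Definition lorentz (u v : hvec) : R :=
  - (u.1.1 * v.1.1) + u.1.2 * v.1.2 + u.2 * v.2.

(* The Lorentz-orthogonal complement of u and v.  A line is represented by its
   pole w, as the zero set of lorentz w; so lcross u v is both the (pole of the)
   line through the points u, v and the common point of the lines with poles
   u, v.  The polar line of (1,p,q) is lorentz (1,p,q) (1,x,y) = 0, that is
   p x + q y = 1. *)
Definition lcross (u v : hvec) : hvec :=
  (- (u.1.2 * v.2 - u.2 * v.1.2),
   u.2 * v.1.1 - u.1.1 * v.2,
   u.1.1 * v.1.2 - u.1.2 * v.1.1).

Definition hline (w : hvec) : set (R * R) :=
  [set p | disk p /\ lorentz w (hom p) = 0].

(* The closed half-plane of the line with pole w containing q (q off the line). *)
Definition half_plane (w q : hvec) : set (R * R) :=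
  [set p | disk p /\ 0 <= lorentz w (hom p) * lorentz w q].

Definition arcosh (x : R) : R := ln (x + Num.sqrt (x ^+ 2 - 1)).

Definition hdist (p q : R * R) : R :=
  arcosh ((1 - p.1 * q.1 - p.2 * q.2) /
    Num.sqrt ((1 - p.1 ^+ 2 - p.2 ^+ 2) * (1 - q.1 ^+ 2 - q.2 ^+ 2))).

Definition hdist_line (p : R * R) (w : hvec) : R :=
  inf [set hdist p q | q in hline w].

(* (1 - x^2 - y^2)^(-3/2) dx dy is the area element, for curvature -1, of the
   metric with distance hdist. *)
Definition harea (S : set (R * R)) : \bar R :=
  (\int[(@lebesgue_measure R \x @lebesgue_measure R)%E]_(p in S)
     ((Num.sqrt (1 - p.1 ^+ 2 - p.2 ^+ 2)) ^- 3)%:E)%E.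

(* The lines perpendicular to the line with pole w are those through w, so
   lcross (hom P) w is the perpendicular at P.  Z is any point of the plane off
   the line PQ, marking the side of PQ on which the region lies. *)
Definition hypercycle_region (P Q Z : R * R) (h : R) : set (R * R) :=
  let w := lcross (hom P) (hom Q) in
  half_plane (lcross (hom P) w) (hom Q)
  `&` half_plane (lcross (hom Q) w) (hom P)
  `&` half_plane w (hom Z)
  `&` [set X | hdist_line X w <= h].

Section orthoscheme.
Variables a b : R.

Definition ptA : hvec := (1, 0, a).
Definition ptB : hvec := (1, b, 0).
Definition ptO : R * R := (0, 0).

(* The last condition says that the line AB meets the open disk.  For fixed b > 1
   it holds for all a > 1 close enough to 1; for fixed a > 1 it fails for all
   large b.  Near (1,+oo), the density is unbounded over admissible pairs (it
   blows up as AB becomes tangent to the circle), so the limit at (1,+oo) only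
   makes sense as the iterated one: a to 1 first, then b to +oo. *)
Definition admissible : Prop :=
  [/\ 1 < a, 1 < b & 1 < (a ^+ 2)^-1 + (b ^+ 2)^-1].

Definition lineOA : hvec := lcross (hom ptO) ptA.
Definition lineOB : hvec := lcross (hom ptO) ptB.
Definition lineAB : hvec := lcross ptA ptB.

Definition ptF : R * R := affine (lcross ptA lineOA).
Definition ptC : R * R := affine (lcross ptA lineAB).
Definition ptD : R * R := affine (lcross ptB lineAB).
Definition ptE : R * R := affine (lcross ptB lineOB).

(* The pentagon FCDEO: the part in the disk of the triangle OAB, truncated by
   the polar lines of its outer vertices A and B. *)
Definition truncated_orthoscheme : set (R * R) :=
  half_plane lineOA ptB `&` half_plane lineOB ptA
  `&` half_plane lineAB (hom ptO)
  `&` half_plane ptA (hom ptO) `&` half_plane ptB (hom ptO).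

Definition ptJ : R * R :=
  ((ptC.1 + ptD.1) / 2, (ptC.2 + ptD.2) / 2).

Definition height1 : R := hdist_line ptJ (lcross (hom ptO) (hom ptE)).
Definition height2 : R := hdist_line ptJ (lcross (hom ptF) (hom ptC)).

(* The vertex D lies off both base lines, on the side of the pentagon. *)
Definition region1 : set (R * R) := hypercycle_region ptO ptE ptD height1.
Definition region2 : set (R * R) := hypercycle_region ptF ptC ptD height2.

Definition density : R :=
  (fine (harea region1) + fine (harea region2)) /
  fine (harea truncated_orthoscheme).

Lemma ptFE : 1 < a -> ptF = (0, a^-1).
Proof.
move=> a1; rewrite /ptF /affine /lcross /=.
by congr pair; field; lra.
Qed.

Lemma ptEE : 1 < b -> ptE = (b^-1, 0).
Proof.
move=> b1; rewrite /ptE /affine /lcross /=.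
by congr pair; field; lra.
Qed.

Lemma ptCE : 1 < a -> 1 < b -> ptC = (b * (1 - (a ^+ 2)^-1), a^-1).
Proof.
move=> a1 b1; rewrite /ptC /affine /lcross /=.
have [a0 b0] : a != 0 /\ b != 0 by split; lra.
by congr pair; field; rewrite ?a0 ?b0.
Qed.

Lemma ptDE : 1 < a -> 1 < b -> ptD = (b^-1, a * (1 - (b ^+ 2)^-1)).
Proof.
move=> a1 b1; rewrite /ptD /affine /lcross /=.
have [a0 b0] : a != 0 /\ b != 0 by split; lra.
by congr pair; field; rewrite ?a0 ?b0.
Qed.

End orthoscheme.
End klein_model.

Arguments hvec R : clear implicits.

(* Main.v *)
Require Import Defs.
From mathcomp Require Import all_boot all_order all_algebra.
From mathcomp Require Import all_classical all_reals all_analysis.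
From mathcomp Require Import measurable_realfun.
From mathcomp Require Import ring lra.
Import Order.TTheory GRing.Theory Num.Theory.
Import numFieldNormedType.Exports.
Local Open Scope classical_set_scope.
Local Open Scope ring_scope.

Set Implicit Arguments.
Unset Strict Implicit.
Unset Printing Implicit Defensive.

(* Put t = 1/a, e = 1/b and s = sqrt (1 - t^2).  Both base lines are horizontal
   chords y = t0, and the perpendiculars to such a chord form the pencil
   x = u (1 - t0 y).  In the coordinates (u, y) the area element of the region
   under a hypercycle has an explicit primitive in y, which gives the area
   |PQ| sinh h; the pentagon is integrated by columns and has area pi / 2.  So
   the density is, for all admissible (a, b),
     (2 / pi) (sinh h1 artanh e + sinh h2 artanh (b s)).
   As a -> 1 we have s -> 0 and artanh (b s) ~ b s, while sinh h2 is of order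
   1 / s: the second term has the finite limit 1 / sqrt (3 - e^2).  As b -> +oo
   the two terms in parentheses tend to 2 / sqrt 3 and 1 / sqrt 3. *)

(** * Derivative rules and the fundamental theorem of calculus *)

Section calculus.
Context {R : realType}.
Implicit Types (f g F : R -> R) (x y a b : R).

(** This rule and the next ones are phrased for explicit abstractions, so that [derive_tac] can
    select them by matching the body of the function. *)
Lemma derive_id1 x : is_derive x 1 (fun y : R => y) 1.
Proof. exact: is_derive_id. Qed.

Lemma derive_cst1 (c : R) x : is_derive x 1 (fun _ : R => c) 0.
Proof. exact: is_derive_cst. Qed.

Lemma derive_add f g (df dg : R) x : is_derive x 1 f df -> is_derive x 1 g dg ->
  is_derive x 1 (fun y => f y + g y) (df + dg).
Proof. exact: is_deriveD. Qed.

Lemma derive_sub f g (df dg : R) x : is_derive x 1 f df -> is_derive x 1 g dg ->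
  is_derive x 1 (fun y => f y - g y) (df - dg).
Proof. exact: is_deriveB. Qed.

Lemma derive_opp f (df : R) x : is_derive x 1 f df ->
  is_derive x 1 (fun y => - f y) (- df).
Proof. exact: is_deriveN. Qed.

Lemma derive_mul f g (df dg : R) x : is_derive x 1 f df -> is_derive x 1 g dg ->
  is_derive x 1 (fun y => f y * g y) (f x * dg + g x * df).
Proof. exact: is_deriveM. Qed.

Lemma derive_exp n f (df : R) x : is_derive x 1 f df ->
  is_derive x 1 (fun y => f y ^+ n.+1) (n.+1%:R * f x ^+ n * df).
Proof.
move=> fd; rewrite (_ : (fun y => f y ^+ n.+1) = f ^+ n.+1); last first.
  by apply/funext => y; rewrite exprfctE.
exact: (@is_derive_eq _ _ _ _ _ _ _ _ (is_deriveX n.+1 fd)).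
Qed.

Lemma derive_inv f (df : R) x : f x != 0 -> is_derive x 1 f df ->
  is_derive x 1 (fun y => (f y)^-1) (- (f x) ^- 2 * df).
Proof. exact: is_deriveV. Qed.

Lemma derive_expt f (df : R) x : 0 < f x -> is_derive x 1 f df ->
  is_derive x 1 (fun y => Num.sqrt (f y)) ((2 * Num.sqrt (f x))^-1 * df).
Proof. by move=> f0 fd; apply: (is_derive1_comp (is_derive1_sqrt f0) fd). Qed.

Lemma derive_ln f (df : R) x : 0 < f x -> is_derive x 1 f df ->
  is_derive x 1 (fun y => ln (f y)) ((f x)^-1 * df).
Proof. by move=> f0 fd; apply: (is_derive1_comp (is_derive1_ln f0) fd). Qed.

Lemma derive_atan f (df : R) x : is_derive x 1 f df ->
  is_derive x 1 (fun y => atan (f y)) ((1 + f x ^+ 2)^-1 * df).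
Proof. by move=> fd; apply: (is_derive1_comp (is_derive1_atan (f x)) fd). Qed.

(** Lets [derive_tac] serve for continuity too: most integrands and limit expressions below are
    shown continuous by differentiating them. *)
Lemma is_derive_continuous f (df : R) x : is_derive x 1 f df -> {for x, continuous f}.
Proof.
move=> [fd _]; apply: differentiable_continuous.
exact/derivable1_diffP.
Qed.

Lemma integral_FTC f F a b : a <= b ->
  (forall x, a <= x <= b -> is_derive x 1 F (f x)) ->
  (forall x, a <= x <= b -> {for x, continuous f}) ->
  (\int[lebesgue_measure]_(x in `[a, b]) (f x)%:E = (F b - F a)%:E)%E.
Proof.
move=> + dF cf; rewrite le_eqVlt => /predU1P[<-|ab].
  by rewrite set_itv1 integral_set1 subrr.
have cF x : a <= x <= b -> {for x, continuous F}.
  by move=> /dF /is_derive_continuous.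
rewrite (@continuous_FTC2 _ f F)//.
- apply: continuous_in_subspaceT => x; rewrite inE/= in_itv/=; exact: cf.
- split.
  + move=> x; rewrite in_itv/= => /andP[ax xb].
    by have [] := dF x _; rewrite ?ltW.
  + by apply: cvg_at_right_filter; apply: cF; rewrite lexx ltW.
  + by apply: cvg_at_left_filter; apply: cF; rewrite lexx ltW.
- move=> x; rewrite in_itv/= => /andP[ax xb].
  by rewrite derive1E; apply: derive_val; apply: dF; rewrite !ltW.
Qed.

End calculus.

(** Descends through the body of the function and builds the derivative in an evar. Nonzero
    denominators and positive arguments of square roots and logarithms remain as goals. *)
Ltac derive_tac := first
  [ eapply derive_cst1 | eapply derive_id1
  | eapply derive_sub; derive_tac | eapply derive_add; derive_tac
  | eapply derive_opp; derive_tac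
  | eapply derive_exp; derive_tac
  | eapply derive_mul; derive_tac
  | eapply derive_inv; [|derive_tac]
  | eapply derive_expt; [|derive_tac]
  | eapply derive_ln; [|derive_tac]
  | eapply derive_atan; derive_tac
  | idtac ].

(** * The inverse hyperbolic tangent *)

Section artanh.
Context {R : realType}.
Implicit Types x : R.

Definition artanh (z : R) : R := (ln (1 + z) - ln (1 - z)) / 2.

Lemma artanh0 : artanh 0 = 0.
Proof. by rewrite /artanh addr0 subr0 subrr mul0r. Qed.

Lemma is_derive_artanh x : -1 < x < 1 -> is_derive x 1 artanh ((1 - x ^+ 2)^-1).
Proof.
move=> /andP[x1 x2]; rewrite /artanh; apply: is_derive_eq.
  by derive_tac; lra.
have -> : 1 - x ^+ 2 = (1 - x) * (1 + x) by ring.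
by field; lra.
Qed.

Lemma derive_artanh (f : R -> R) (df : R) x : -1 < f x < 1 -> is_derive x 1 f df ->
  is_derive x 1 (fun y => artanh (f y)) ((1 - f x ^+ 2)^-1 * df).
Proof. by move=> f1 fd; apply: (is_derive1_comp (is_derive_artanh f1) fd). Qed.

(** Both bounds come from ln (1 + v) <= v, with v = 2x/(1 - x) for the upper one and v = -2x/(1 + x)
    for the lower one. *)
Lemma artanh_bounds x : 0 < x < 1 -> x / (1 + x) <= artanh x <= x / (1 - x).
Proof.
move=> /andP[x0 x1].
have a : ln (1 + x) - ln (1 - x) <= 2 * (x / (1 - x)).
  rewrite -ln_div ?posrE; [|lra|lra].
  have -> : (1 + x) / (1 - x) = 1 + 2 * (x / (1 - x)) by field; lra.
  by apply: le_ln1Dx; rewrite (lt_trans (ltrN10 _))// mulr_gt0// divr_gt0//; lra.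
have b : ln (1 - x) - ln (1 + x) <= - (2 * (x / (1 + x))).
  rewrite -ln_div ?posrE; [|lra|lra].
  have -> : (1 - x) / (1 + x) = 1 + - (2 * (x / (1 + x))) by field; lra.
  apply: le_ln1Dx; rewrite ltrN2 mulrA ltr_pdivrMr; lra.
rewrite /artanh; lra.
Qed.

End artanh.

(** * Lebesgue measure under a linear change of variable *)

Section measure.
Context {R : realType}.
Local Notation mu := (@lebesgue_measure R).
Local Open Scope ereal_scope.

(** By uniqueness of Lebesgue measure it suffices to compare on half-open intervals. For c < 0 the
    preimage is half-open at the other end, which does not change its length. *)
Lemma lebesgue_measure_scale (c : R) (A : set R) : c != 0%R -> measurable A ->
  `|c|%:E * mu (( *%R c : _ -> measurableTypeR R) @^-1` A) = mu A.
Proof.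
move=> c0 mA.
have mc : measurable_fun [set: measurableTypeR R]
    ( *%R c : measurableTypeR R -> measurableTypeR R) by [].
pose phi : measurableTypeR R -> measurableTypeR R := *%R c.
have c1 : (0 <= `|c|)%R by [].
apply/esym.
apply: (@lebesgue_measure_unique R (mscale (NngNum c1) (pushforward mu phi))) => //.
move=> _ [[a b] _ <-]; rewrite /mscale/= /pushforward/= /mscale/=.
have [cp|cn] : (0 < c \/ c < 0)%R.
  by move: c0; rewrite neq_lt => /orP[]; [right|left].
- rewrite [X in (_ * lebesgue_measure X)](_ : _ = `](a / c)%R, (b / c)%R]%classic); last first.
    by apply/seteqP; split => x/=; rewrite !in_itv/= ltr_pdivrMr// ler_pdivlMr// mulrC.
  rewrite !lebesgue_measure_itv/= !lte_fin gtr0_norm// ltr_pM2r ?invr_gt0//.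
  case: ifPn => _; last by rewrite mule0.
  by rewrite -!EFinB -EFinM -mulrBl mulrC divfK.
- rewrite [X in (_ * lebesgue_measure X)](_ : _ = `[(b / c)%R, (a / c)%R[%classic); last first.
    by apply/seteqP; split => x/=; rewrite !in_itv/= ltr_ndivlMr// ler_ndivrMr//;
      rewrite mulrC andbC.
  rewrite !lebesgue_measure_itv/= !lte_fin ltr0_norm// ltr_nM2r ?invr_lt0//.
  case: ifPn => _; last by rewrite mule0.
  by rewrite -!EFinB -EFinM -mulrBl mulNr mulrC divfK// opprB.
Qed.

Lemma integral_scale (c : R) (f : R -> \bar R) : c != 0%R ->
  measurable_fun [set: R] f -> (forall x, 0 <= f x) ->
  \int[mu]_x f x = \int[mu]_x (`|c|%:E * f (c * x)%R).
Proof.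
move=> c0 mf f0.
have mc : measurable_fun [set: measurableTypeR R]
    ( *%R c : measurableTypeR R -> measurableTypeR R) by [].
have mfc : measurable_fun [set: R] (fun x => f (c * x)%R) by exact: measurableT_comp mf mc.
rewrite ge0_integralZl//.
pose phi : measurableTypeR R -> measurableTypeR R := *%R c.
have c1 : (0 <= `|c|)%R by [].
have -> : \int[mu]_x f (c * x)%R = \int[pushforward mu phi]_x f x.
  by rewrite ge0_integral_pushforward.
rewrite -(@ge0_integral_mscale _ _ _ (pushforward mu phi) _ measurableT (NngNum c1))//.
by apply: eq_measure_integral => A mA _; exact/esym/(lebesgue_measure_scale c0 mA).
Qed.

End measure.

Ltac measurable_tac := repeat match goal with
  | |- measurable_fun _ fst => exact: measurable_fst
  | |- measurable_fun _ snd => exact: measurable_snd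
  | |- measurable_fun _ (fun p => p.1) => exact: measurable_fst
  | |- measurable_fun _ (fun p => p.2) => exact: measurable_snd
  | |- measurable_fun _ (fun=> _) => exact: measurable_cst
  | |- measurable_fun _ (fun p => _ && _) => apply: measurable_and
  | |- measurable_fun _ (fun p => _ <= _) => apply: measurable_fun_ler
  | |- measurable_fun _ (fun p => _ < _) => apply: measurable_fun_ltr
  | |- measurable_fun _ (fun p => _ - _) => apply: measurable_funB
  | |- measurable_fun _ (fun p => _ + _) => apply: measurable_funD
  | |- measurable_fun _ (fun p => _ * _) => apply: measurable_funM
  | |- measurable_fun _ (fun p => _ ^+ _) => apply: measurable_funX
  end.

(** * Hyperbolic area as an iterated integral *)

Section harea.
Context {R : realType}.
Local Notation mu := (@lebesgue_measure R).

Lemma tonelli (f : R * R -> \bar R) :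
  measurable_fun [set: R * R] f -> (forall p, 0 <= f p)%E ->
  (\int[mu]_x \int[mu]_y f (x, y) = \int[mu]_y \int[mu]_x f (x, y))%E.
Proof. by move=> mf f0; have := @fubini_tonelli _ _ _ _ R mu mu _ mf f0. Qed.

Lemma measurable_slice_integral (f : R * R -> \bar R) :
  measurable_fun [set: R * R] f -> (forall p, 0 <= f p)%E ->
  measurable_fun [set: R] (fun x => \int[mu]_y f (x, y))%E.
Proof.
by move=> mf f0; have := @measurable_fun_fubini_tonelli_F _ _ _ _ R mu _ mf f0.
Qed.

Lemma measurable_pred d (T : measurableType d) (P : T -> bool) :
  measurable_fun [set: T] P -> measurable [set x | P x].
Proof. by move=> mP; rewrite -[X in measurable X]setTI; exact: (mP measurableT [set true]). Qed.

Definition hdensity (p : R * R) : R := (Num.sqrt (1 - p.1 ^+ 2 - p.2 ^+ 2)) ^- 3.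

Lemma hdensity_ge0 p : 0 <= hdensity p.
Proof. by rewrite invr_ge0 exprn_ge0// sqrtr_ge0. Qed.

Lemma measurable_hdensity : measurable_fun [set: R * R] hdensity.
Proof.
(* As a real power the inverse cube is measurable on the whole line, including 0, where both
   expressions take the value 0. *)
have -> : hdensity = fun p => (Num.sqrt (1 - p.1 ^+ 2 - p.2 ^+ 2)) `^ (- 3%:R).
  by apply/funext => p; rewrite powR_invn// sqrtr_ge0.
apply: (measurableT_comp (measurable_powR (- 3%:R))).
have ms : measurable_fun [set: R] (@Num.sqrt R).
  by apply: continuous_measurable_fun; exact: sqrt_continuous.
apply: (measurableT_comp ms).
by measurable_tac.
Qed.

(** Extension by zero off [S], which turns areas into integrals over the whole plane, where Tonelli
    applies. *)
Definition hweight (S : set (R * R)) : R * R -> \bar R := (EFin \o hdensity) \_ S.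

Lemma hweight_ge0 S p : (0 <= hweight S p)%E.
Proof. by rewrite /hweight patchE; case: ifP => //= _; rewrite lee_fin hdensity_ge0. Qed.

Lemma measurable_hweight (S : set (R * R)) : measurable S -> measurable_fun [set: R * R] (hweight S).
Proof.
move=> mS; apply/(measurable_restrictT _ mS)/measurable_funTS/measurable_EFinP.
exact: measurable_hdensity.
Qed.

Lemma harea_xy (S : set (R * R)) : measurable S ->
  harea S = (\int[mu]_x \int[mu]_y hweight S (x, y))%E.
Proof.
move=> mS; rewrite /harea integral_mkcond fubini_tonelli1//.
- exact: measurable_hweight.
- exact: hweight_ge0.
Qed.

Lemma harea_yx (S : set (R * R)) : measurable S ->
  harea S = (\int[mu]_y \int[mu]_x hweight S (x, y))%E.
Proof.
move=> mS; rewrite (harea_xy mS).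
exact: (tonelli (measurable_hweight mS) (@hweight_ge0 S)).
Qed.

(** The area element is even in y. This is needed because the pencil regions below lie under their
    chord, while the first hypercycle region lies above y = 0. *)
Lemma harea_reflect (S : set (R * R)) : measurable S ->
  harea [set p | S (p.1, - p.2)] = harea S.
Proof.
move=> mS.
have mS' : measurable [set p : R * R | S (p.1, - p.2)].
  rewrite -[X in measurable X]setTI.
  apply: (_ : measurable_fun setT (fun p : R * R => (p.1, - p.2))) => //.
  by apply: measurable_fun_pair => //; exact: measurableT_comp.
rewrite (harea_xy mS) (harea_xy mS').
apply: eq_integral => x _.
rewrite [RHS](@integral_scale _ (-1))//; last first.
- by move=> y; exact: hweight_ge0.
- apply: measurableT_comp; [exact: measurable_hweight|].
  exact: measurable_fun_pair.
apply: eq_integral => y _.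
rewrite normrN1 mul1e mulN1r /hweight !patchE.
have -> : ((x, y) \in [set p : R * R | S (p.1, - p.2)]) = ((x, - y) \in S).
  by apply/idP/idP; rewrite !inE.
by rewrite /hdensity/= sqrrN.
Qed.

End harea.

(** * Coordinates along the pencil of perpendiculars to a horizontal chord *)

Section pencil.
Context {R : realType}.
Local Notation mu := (@lebesgue_measure R).

(** The roots of a z^2 - 2bz - c are (b + d)/a >= 0 and (b - d)/a <= 0 with d = sqrt (b^2 + ac), so
    on z >= 0 only the first one bounds the solution set. *)
Lemma quadratic_le_root (a b c : R) : 0 < a -> 0 <= b -> 0 <= c ->
  exists2 z0, 0 <= z0 & a * z0 ^+ 2 = 2 * b * z0 + c /\
    forall z, 0 <= z -> (a * z ^+ 2 <= 2 * b * z + c) = (z <= z0).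
Proof.
move=> a0 b0 c0; set d := Num.sqrt (b ^+ 2 + a * c).
have dE : d ^+ 2 = b ^+ 2 + a * c by rewrite sqr_sqrtr// addr_ge0 ?mulr_ge0 ?sqr_ge0// ltW.
have d0 : 0 <= d by exact: sqrtr_ge0.
have z0E : a * ((b + d) / a) = b + d by rewrite mulrC divfK// gt_eqF.
have z00 : 0 <= (b + d) / a by rewrite divr_ge0 ?addr_ge0// ltW.
have bd : b <= d by rewrite -(ler_pXn2r (n := 2)) ?nnegrE// dE lerDl mulr_ge0// ltW.
exists ((b + d) / a) => //; set z0 := (b + d) / a in z0E z00 *.
have E : a * z0 ^+ 2 = 2 * b * z0 + c.
  apply: (mulfI (lt0r_neq0 a0)); have -> : a * (a * z0 ^+ 2) = (a * z0) ^+ 2 by ring.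
  have -> : a * (2 * b * z0 + c) = 2 * b * (a * z0) + a * c by ring.
  rewrite z0E; ring: dE.
split => // z zge.
have F : a * z ^+ 2 - (2 * b * z + c) = (z - z0) * (a * z + (d - b)).
  have -> : c = a * z0 ^+ 2 - 2 * b * z0 by rewrite E; ring.
  have -> : d = a * z0 - b by rewrite z0E; ring.
  ring.
rewrite -subr_le0 F -[in RHS]subr_le0.
(* At z = 0 the second factor d - b may vanish, so the sign argument needs z > 0. *)
have [->|zn0] := eqVneq z 0; first by rewrite mulr0 !add0r mulNr !oppr_le0 z00 mulr_ge0// subr_ge0.
by rewrite pmulr_lle0// ltr_wpDr ?subr_ge0// mulr_gt0// lt_def zn0.
Qed.

(* The lines x = u (1 - t y) are the perpendiculars to the chord y = t; the last
   condition is a bound M / sqrt (1 - t^2) on the sinh of the distance to it. *)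
Definition pencil_region (t u0 M : R) : set (R * R) :=
  [set p | [&& p.1 ^+ 2 + p.2 ^+ 2 < 1, 0 <= p.1, p.1 <= u0 * (1 - t * p.2), p.2 <= t &
    (t - p.2) ^+ 2 <= M ^+ 2 * (1 - p.1 ^+ 2 - p.2 ^+ 2)]].

Lemma measurable_pencil_region t u0 M : measurable (pencil_region t u0 M).
Proof. by apply: measurable_pred; measurable_tac. Qed.

(** For fixed y substitute x = (1 - t y) u, with Jacobian |1 - t y|, then exchange the order of
    integration. *)
Lemma harea_shear (t : R) (S : set (R * R)) : 0 <= t < 1 -> measurable S -> S `<=` disk ->
  harea S = (\int[mu]_u \int[mu]_y
    (`|(1 - t * y)%R|%:E * hweight S ((1 - t * y)%R * u, y)%R))%E.
Proof.
move=> /andP[t0 t1] mS Sd; rewrite (harea_yx mS).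
have mf : measurable_fun [set: R * R]
    (fun p : R * R => (`|(1 - t * p.2)%R|%:E * hweight S ((1 - t * p.2) * p.1, p.2)%R)%E).
  apply: emeasurable_funM.
    apply/measurable_EFinP; apply: measurableT_comp => //.
    by measurable_tac.
  apply: measurableT_comp; first exact: measurable_hweight.
  by apply: measurable_fun_pair => //; measurable_tac.
rewrite (tonelli mf)/=; last by move=> p; rewrite mule_ge0// hweight_ge0.
apply: eq_integral => y _.
(* The substitution degenerates only at y = 1/t > 1, a line that misses the disk, so both inner
   integrals vanish there. *)
have [ty|ty] := eqVneq (1 - t * y) 0.
  rewrite !integral0_eq// => x _.
    by rewrite ty normr0 mul0e.
  rewrite /hweight patchE; case: ifPn => //; rewrite inE => /Sd; rewrite /disk/= => xy.
  exfalso; nra.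
rewrite (@integral_scale _ (1 - t * y))//.
- apply: measurableT_comp; [exact: measurable_hweight|].
  exact: measurable_fun_pair.
- by move=> x; exact: hweight_ge0.
Qed.


Section column.
Variables t u M : R.
Hypotheses (t01 : 0 <= t < 1) (u1 : u ^+ 2 * (1 - t ^+ 2) < 1) (M0 : 0 < M).
(** [N y] is 1 - x^2 - y^2 at x = (1 - t y) u; on the chord it equals (1 - t^2) q. *)
Let q := 1 - u ^+ 2 * (1 - t ^+ 2).
Let N y := 1 - ((1 - t * y) * u) ^+ 2 - y ^+ 2.

Let q0 : 0 < q. Proof. by rewrite subr_gt0. Qed.

Let NE y : N y = (1 - t ^+ 2) * q + 2 * (t * q) * (t - y) - (1 + u ^+ 2 * t ^+ 2) * (t - y) ^+ 2.
Proof. rewrite /N /q; ring. Qed.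

(** In the depth z = t - y the height condition is a quadratic inequality as in [quadratic_le_root],
    so the column is a segment of depth [z0]. The disk condition is then automatic: [N y] is at
    least (t - y)^2 / M^2 off the chord and (1 - t^2) q > 0 on it. *)
Lemma pencil_column : exists z0 : R, [/\ 0 <= z0,
   z0 = M * Num.sqrt (N (t - z0)) &
   forall y, (t - z0 <= y <= t) = [&& 0 < N y, y <= t & (t - y) ^+ 2 <= M ^+ 2 * N y]].
Proof.
move: t01 => /andP[t0 t1].
have s0 : 0 < 1 - t ^+ 2 by nra.
have M2 : 0 < M ^+ 2 by rewrite exprn_gt0.
have Mi : 0 < (M ^+ 2)^-1 by rewrite invr_gt0.
have a0 : 0 < (M ^+ 2)^-1 + (1 + u ^+ 2 * t ^+ 2) by have := sqr_ge0 (u * t); rewrite exprMn; lra.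
have c0 : 0 < (1 - t ^+ 2) * q by rewrite mulr_gt0.
have [z0 z00 [z0E z0le]] := quadratic_le_root a0 (mulr_ge0 t0 (ltW q0)) (ltW c0).
have ME y : ((t - y) ^+ 2 <= M ^+ 2 * N y) =
    (((M ^+ 2)^-1 + (1 + u ^+ 2 * t ^+ 2)) * (t - y) ^+ 2 <= 2 * (t * q) * (t - y) + (1 - t ^+ 2) * q).
  by rewrite -ler_pdivrMl// NE; apply/idP/idP => h; lra.
have N0 y : t - z0 <= y <= t -> (t - y) ^+ 2 <= M ^+ 2 * N y.
  by move=> /andP[y1 y2]; rewrite ME z0le; lra.
have Npos y : t - z0 <= y <= t -> 0 < N y.
  move=> h; have [->|yt] := eqVneq y t.
    by rewrite NE subrr expr0n/= !mulr0 subr0 addr0.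
  rewrite -(pmulr_rgt0 _ M2); apply: lt_le_trans (N0 _ h).
  by rewrite exprn_even_gt0//= subr_eq0 eq_sym.
exists z0; split => //.
- have zE : z0 ^+ 2 = M ^+ 2 * N (t - z0).
    rewrite NE opprB [t + _]addrC subrK.
    by rewrite -[LHS](mulVKf (lt0r_neq0 M2)); congr (_ * _); lra.
  have Nz : 0 <= N (t - z0) by apply/ltW/Npos; lra.
  apply/eqP; rewrite -(@eqrXn2 _ 2)//; last by rewrite mulr_ge0 ?sqrtr_ge0// ltW.
  by rewrite exprMn sqr_sqrtr// -zE.
- move=> y; apply/idP/idP => [h|/and3P[_ yt]].
    by rewrite (Npos _ h) (N0 _ h) (andP h).2.
  by rewrite ME z0le; lra.
Qed.

(* Up to a constant factor the primitive (y - t) / (q sqrt (N y)) is the signed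
   sinh of the distance to the chord y = t. *)
Lemma pencil_column_integral z0 : 0 <= z0 -> z0 = M * Num.sqrt (N (t - z0)) ->
  (forall y, t - z0 <= y <= t -> 0 < N y) ->
  (\int[mu]_(y in `[(t - z0)%R, t]) ((1 - t * y) * Num.sqrt (N y) ^- 3)%:E = (M / q)%:E)%E.
Proof.
move=> z00 z0E Npos.
pose F y := (y - t) / Num.sqrt (N y) / q.
have r0 y : t - z0 <= y <= t -> 0 < Num.sqrt (N y) by move=> /Npos; rewrite sqrtr_gt0.
transitivity (F t - F (t - z0))%:E; first (apply: integral_FTC; first lra).
- move=> y h; rewrite /F /N; apply: is_derive_eq.
    derive_tac; rewrite -/(N y) ?Npos//.
    by rewrite gt_eqF// r0.
  have rE : Num.sqrt (N y) ^+ 2 = N y by rewrite sqr_sqrtr// ltW// Npos.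
  have rn : Num.sqrt (N y) != 0 by rewrite gt_eqF// r0.
  rewrite -/(N y); set r := Num.sqrt (N y) in rE rn *.
  move: rE; rewrite /N => rE.
  have qn := lt0r_neq0 q0; rewrite /q in qn *.
  by field: rE; rewrite rn qn.
- move=> y h; apply: is_derive_continuous; derive_tac; rewrite -/(N y) ?Npos//.
  by rewrite expf_neq0// gt_eqF// r0.
congr EFin; rewrite /F subrr !mul0r sub0r.
have rn : Num.sqrt (N (t - z0)) != 0 by rewrite gt_eqF// r0//; lra.
have qn := lt0r_neq0 q0.
rewrite {1}z0E; set r := Num.sqrt _ in rn *.
by field; rewrite qn rn.
Qed.

End column.

End pencil.

Lemma mem_setb (T : Type) (P : T -> bool) x : (x \in [set p | P p]) = P x.
Proof. by apply/idP/idP; rewrite inE. Qed.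

(** * The area under a hypercycle *)

Section pencil_area.
Context {R : realType}.
Local Notation mu := (@lebesgue_measure R).

Lemma pencil_region_disk (t u0 M : R) : pencil_region t u0 M `<=` disk.
Proof. by move=> p /and5P[]. Qed.

(** Below the chord 1 - t y > 0, so this factor cancels from the bounds on x and leaves 0 <= u <=
    u0. *)
Lemma pencil_slice (t u0 M u y : R) : 0 <= t < 1 -> 0 <= u0 ->
  ((((1 - t * y) * u, y) : R * R) \in pencil_region t u0 M) =
  (0 <= u <= u0) && [&& 0 < 1 - ((1 - t * y) * u) ^+ 2 - y ^+ 2, y <= t &
    (t - y) ^+ 2 <= M ^+ 2 * (1 - ((1 - t * y) * u) ^+ 2 - y ^+ 2)].
Proof.
move=> /andP[t0 t1] u00; rewrite /pencil_region mem_setb /=.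
have [yt|yt] := leP y t; last by rewrite /= !andbF.
have ty : 0 < 1 - t * y by nra.
rewrite /= pmulr_rge0// [u0 * _]mulrC ler_pM2l//.
have -> : (((1 - t * y) * u) ^+ 2 + y ^+ 2 < 1) = (0 < 1 - ((1 - t * y) * u) ^+ 2 - y ^+ 2).
  by apply/idP/idP; lra.
by rewrite -!andbA andbCA; congr (_ && _); rewrite andbCA.
Qed.

(** The column at u contributes M / (1 - u^2 s^2) with s = sqrt (1 - t^2), whose primitive is (M /
    s) artanh (u s). Here M / s is the sinh of the height and artanh (u0 s) the hyperbolic length of
    the base. *)
Lemma harea_pencil (t u0 M : R) : 0 <= t < 1 -> 0 <= u0 -> u0 ^+ 2 * (1 - t ^+ 2) < 1 -> 0 < M ->
  harea (pencil_region t u0 M) =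
  (M / Num.sqrt (1 - t ^+ 2) * artanh (u0 * Num.sqrt (1 - t ^+ 2)))%:E.
Proof.
move=> t01 u00 us M0; rewrite (harea_shear t01)//; first last.
- exact: pencil_region_disk.
- exact: measurable_pencil_region.
have [t0 t1] := andP t01.
pose q u := 1 - u ^+ 2 * (1 - t ^+ 2).
have s0 : 0 < 1 - t ^+ 2 by nra.
transitivity (\int[mu]_(u in `[0%R, u0]) (M / q u)%:E)%E.
  rewrite [RHS]integral_mkcond; apply: eq_integral => u _.
  rewrite patchE mem_setb/= in_itv/=; case: ifPn => [/andP[u1 u2]|uu]; last first.
    rewrite integral0_eq// => y _.
    by rewrite /hweight patchE pencil_slice// (negbTE uu) mule0.
  have us' : u ^+ 2 * (1 - t ^+ 2) < 1.
    by apply: le_lt_trans us; rewrite ler_pM2r// ler_pXn2r// nnegrE.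
  have [z0 [z00 z0E zP]] := pencil_column t01 us' M0.
  rewrite -(pencil_column_integral us' z00 z0E); last first.
    by move=> y; rewrite zP => /and3P[].
  rewrite [RHS]integral_mkcond; apply: eq_integral => y _.
  rewrite patchE mem_setb/= in_itv/= zP /hweight patchE pencil_slice// u1 u2/=.
  case: ifPn => [/and3P[_ yt _]|_]; last by rewrite mule0.
  by rewrite -EFinM /hdensity/= ger0_norm//; nra.
set s := Num.sqrt (1 - t ^+ 2).
have sE : s ^+ 2 = 1 - t ^+ 2 by rewrite sqr_sqrtr// ltW.
have sp : 0 < s by rewrite sqrtr_gt0.
have us1 u : 0 <= u <= u0 -> -1 < u * s < 1.
  move=> /andP[u1 u2]; have us0 : 0 <= u * s by rewrite mulr_ge0// ltW.
  have : (u * s) ^+ 2 < 1 ^+ 2.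
    rewrite exprMn sE expr1n; apply: le_lt_trans us; rewrite ler_pM2r// ler_pXn2r// nnegrE//.
  by rewrite ltr_pXn2r ?nnegrE// => h; lra.
have q0 u : 0 <= u <= u0 -> 0 < q u.
  by move=> /us1 /andP[h1 h2]; rewrite /q -sE -exprMn; nra.
transitivity ((M / s * artanh (u0 * s)) - (M / s * artanh (0 * s)))%:E; last first.
  by rewrite mul0r artanh0 mulr0 subr0.
apply: (@integral_FTC _ _ (fun u => M / s * artanh (u * s))) => // u h.
- apply: is_derive_eq.
    eapply derive_mul; first exact: derive_cst1.
    eapply derive_artanh; [exact: us1|derive_tac].
  have := q0 _ h; rewrite /q -sE -exprMn => qn.
  by field; rewrite !gt_eqF.
- apply: is_derive_continuous; rewrite /q; derive_tac.
  by rewrite gt_eqF// q0.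
Qed.

End pencil_area.

(** * The area of the pentagon *)

Section pentagon.
Context {R : realType}.
Local Notation mu := (@lebesgue_measure R).

Lemma atan_inv (v : R) : 0 < v -> atan v + atan v^-1 = pi / 2.
Proof.
move=> v0; have a0 : 0 < atan v by rewrite -atan0 lt_atan.
have a1 := atan_ltpi2 v.
suff -> : v^-1 = tan (pi / 2 - atan v) by rewrite tanK ?in_itv/=; lra.
rewrite /tan sinB cosB sin_pihalf cos_pihalf !mul0r !mul1r subr0 add0r.
by rewrite -{1}(atanK v) /tan invf_div.
Qed.

Lemma integral_column (x Y : R) : 0 <= Y -> x ^+ 2 + Y ^+ 2 < 1 ->
  (\int[mu]_(y in `[0%R, Y]) (Num.sqrt (1 - x ^+ 2 - y ^+ 2) ^- 3)%:E =
   (Y / ((1 - x ^+ 2) * Num.sqrt (1 - x ^+ 2 - Y ^+ 2)))%:E)%E.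
Proof.
move=> Y0 xY.
pose F (y : R) := y / ((1 - x ^+ 2) * Num.sqrt (1 - x ^+ 2 - y ^+ 2)).
have N0 y : 0 <= y <= Y -> 0 < 1 - x ^+ 2 - y ^+ 2 by move=> /andP[y0 y1]; nra.
have r0 y : 0 <= y <= Y -> 0 < Num.sqrt (1 - x ^+ 2 - y ^+ 2) by move=> /N0; rewrite sqrtr_gt0.
have x0 : 0 < 1 - x ^+ 2 by have := sqr_ge0 Y; lra.
transitivity (F Y - F 0)%:E; last by rewrite /F mul0r subr0.
apply: integral_FTC => // y h.
- apply: is_derive_eq.
    rewrite /F; derive_tac; rewrite ?N0//.
    by rewrite mulf_neq0// gt_eqF// r0.
  have rE : Num.sqrt (1 - x ^+ 2 - y ^+ 2) ^+ 2 = 1 - x ^+ 2 - y ^+ 2 by rewrite sqr_sqrtr// ltW// N0.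
  have rn : Num.sqrt (1 - x ^+ 2 - y ^+ 2) != 0 by rewrite gt_eqF// r0.
  set r := Num.sqrt _ in rE rn *.
  by field: rE; rewrite rn gt_eqF.
- apply: is_derive_continuous; derive_tac; rewrite ?N0//.
  by rewrite expf_neq0// gt_eqF// r0.
Qed.

(** For t = 1/a and e = 1/b, the lines x = e and y = t are the polar lines of B and A, and e x + t y
    = 1 is AB. *)
Definition pentagon (t e : R) : set (R * R) :=
  [set p | [&& p.1 ^+ 2 + p.2 ^+ 2 < 1, 0 <= p.1, p.1 <= e, 0 <= p.2, p.2 <= t &
    e * p.1 + t * p.2 <= 1]].

Lemma measurable_pentagon t e : measurable (pentagon t e).
Proof. by apply: measurable_pred; measurable_tac. Qed.

Section area.
Variables t e : R.
Hypotheses (t01 : 0 < t < 1) (e01 : 0 < e < 1) (te : 1 < t ^+ 2 + e ^+ 2).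

(** The abscissa of the vertex C, where the top of the column passes from y = t to the line AB. *)
Let c := (1 - t ^+ 2) / e.

Let cP : [/\ 0 < c, c < e, c * e = 1 - t ^+ 2 & c ^+ 2 + t ^+ 2 < 1].
Proof.
have [/andP[t0 t1] /andP[e0 e1]] := (t01, e01).
have ceE : c * e = 1 - t ^+ 2 by rewrite /c divfK// gt_eqF.
have c0 : 0 < c by rewrite /c divr_gt0// subr_gt0 exprn_ilt1 // ltW.
have ce : c < e by rewrite /c ltr_pdivrMr// -expr2; move: te; lra.
by split => //; nra.
Qed.

Let disk_low x : 0 <= x <= c -> x ^+ 2 + t ^+ 2 < 1.
Proof. by have [c0 ce ceE ct] := cP; move=> /andP[x0 xc]; nra. Qed.

(** With m = t^2 + e^2 - 1, the claim multiplied by t^2 is m (1 - x^2) - (e - x)^2 > 0. Replacing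
    one factor e - x by e - c = m/e leaves the lower bound m x (1 - e x) / e. *)
Let disk_high x : c <= x <= e -> x ^+ 2 + ((1 - e * x) / t) ^+ 2 < 1.
Proof.
have [c0 ce ceE ct] := cP; move=> /andP[x0 xc].
have [/andP[t0 t1] /andP[e0 e1]] := (t01, e01).
have t2 : 0 < t ^+ 2 by rewrite exprn_gt0.
rewrite -subr_gt0 -(pmulr_rgt0 _ t2).
have -> : t ^+ 2 * (1 - (x ^+ 2 + ((1 - e * x) / t) ^+ 2)) =
    (t ^+ 2 + e ^+ 2 - 1) * (1 - x ^+ 2) - (e - x) ^+ 2 by field; rewrite gt_eqF.
set m := t ^+ 2 + e ^+ 2 - 1.
have m0 : 0 < m by rewrite /m; move: te; lra.
have ecE : (e - c) * e = m by rewrite mulrBl ceE /m; lra.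
have ex : (e - x) ^+ 2 <= (e - x) * (e - c) by rewrite expr2 ler_wpM2l//; lra.
apply: lt_le_trans (lerB (lexx _) ex).
rewrite -(pmulr_lgt0 _ e0).
have -> : (m * (1 - x ^+ 2) - (e - x) * (e - c)) * e = m * (x * (1 - x * e)).
  by rewrite mulrBl -(mulrA (e - x)) ecE; ring.
rewrite mulr_gt0// mulr_gt0//; nra.
Qed.

(** Covers both ranges of x: the last hypothesis says that [Y] is the lower of the two upper edges
    at x. *)
Lemma pentagon_column x Y : 0 <= x <= e -> x ^+ 2 + Y ^+ 2 < 1 -> 0 <= Y ->
  (forall y, 0 <= y -> (y <= Y) = (y <= t) && (e * x + t * y <= 1)) ->
  (\int[mu]_y hweight (pentagon t e) (x, y) =
   (Y / ((1 - x ^+ 2) * Num.sqrt (1 - x ^+ 2 - Y ^+ 2)))%:E)%E.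
Proof.
move=> /andP[x0 xe] xY Y0 YP; rewrite -integral_column//.
rewrite [RHS]integral_mkcond; apply: eq_integral => y _.
rewrite /hweight !patchE !mem_setb/= in_itv/= x0 xe/=.
have [y0|y0] := leP 0 y; last by rewrite /= !andbF.
rewrite /= YP//; case: (boolP ((y <= t) && _)) => [h|]; last by rewrite andbF.
by rewrite andbT; have -> : x ^+ 2 + y ^+ 2 < 1 by move: h; rewrite -YP// => h; nra.
Qed.


Lemma pentagon_low : (\int[mu]_(x in `[0%R, c])
  (t / ((1 - x ^+ 2) * Num.sqrt (1 - x ^+ 2 - t ^+ 2)))%:E =
  (atan (t * c / Num.sqrt (1 - c ^+ 2 - t ^+ 2)))%:E)%E.
Proof.
have [c0 ce ceE ct] := cP; have [t0 t1] := andP t01.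
pose F (x : R) := atan (t * x / Num.sqrt (1 - x ^+ 2 - t ^+ 2)).
have N0 x : 0 <= x <= c -> 0 < 1 - x ^+ 2 - t ^+ 2 by move=> /disk_low; lra.
have r0 x : 0 <= x <= c -> 0 < Num.sqrt (1 - x ^+ 2 - t ^+ 2) by move=> /N0; rewrite sqrtr_gt0.
have x0 x : 0 <= x <= c -> 0 < 1 - x ^+ 2 by move=> /disk_low; have := sqr_ge0 t; lra.
transitivity (F c - F 0)%:E; last by rewrite /F mulr0 mul0r atan0 subr0.
apply: integral_FTC => [|x h|x h]; first exact: ltW.
- apply: is_derive_eq.
    rewrite /F; derive_tac; rewrite ?N0//.
    by rewrite gt_eqF// r0.
  have rE : Num.sqrt (1 - x ^+ 2 - t ^+ 2) ^+ 2 = 1 - x ^+ 2 - t ^+ 2 by rewrite sqr_sqrtr// ltW// N0.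
  have rp := r0 _ h; set r := Num.sqrt _ in rE rp *.
  have rn : r != 0 by rewrite gt_eqF.
  have xn : 1 - x ^+ 2 != 0 by rewrite gt_eqF// x0.
  have tE : t ^+ 2 = 1 - x ^+ 2 - r ^+ 2 by rewrite rE; ring.
  (* Here r^2 + x^2 = 1 - t^2, so the factor 1 - x^2 of the integrand appears. *)
  have -> : 1 + (t * x / r) ^+ 2 = (1 - x ^+ 2) * (r ^+ 2 + x ^+ 2) / r ^+ 2 by field: tE.
  have r2 : r ^+ 2 + x ^+ 2 != 0 by rewrite gt_eqF// ltr_wpDr ?sqr_ge0// exprn_gt0.
  by field; rewrite rn xn r2.
- apply: is_derive_continuous; derive_tac; rewrite ?N0//.
  by rewrite mulf_neq0// gt_eqF// ?r0 ?x0.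
Qed.

Let Y (x : R) := (1 - e * x) / t.

Lemma pentagon_high : (\int[mu]_(x in `[c, e])
  (Y x / ((1 - x ^+ 2) * Num.sqrt (1 - x ^+ 2 - Y x ^+ 2)))%:E =
  (atan ((e - c) / (t * Num.sqrt (1 - c ^+ 2 - t ^+ 2))))%:E)%E.
Proof.
have [c0 ce ceE ct] := cP; have [t0 t1] := andP t01.
pose F (x : R) := - atan ((e - x) / (t * Num.sqrt (1 - x ^+ 2 - Y x ^+ 2))).
have N0 x : c <= x <= e -> 0 < 1 - x ^+ 2 - Y x ^+ 2 by move=> /disk_high; rewrite /Y; lra.
have r0 x : c <= x <= e -> 0 < Num.sqrt (1 - x ^+ 2 - Y x ^+ 2) by move=> /N0; rewrite sqrtr_gt0.
have x0 x : c <= x <= e -> 0 < 1 - x ^+ 2 by move=> /disk_high; have := sqr_ge0 (Y x); rewrite /Y; lra.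
have tn : t != 0 by rewrite gt_eqF.
transitivity (F e - F c)%:E; last first.
  have -> : t = Y c by rewrite /Y [e * c]mulrC ceE; field.
  rewrite /F subrr mul0r atan0 oppr0 sub0r opprK /Y [e * c]mulrC ceE.
  by congr (atan (_ / (_ * _)))%:E; field.
apply: integral_FTC => [|x h|x h]; first exact: ltW.
- apply: is_derive_eq.
    rewrite /F /Y; derive_tac; rewrite -/(Y x) ?N0//.
    by rewrite mulf_neq0// gt_eqF// r0.
  have rE : Num.sqrt (1 - x ^+ 2 - Y x ^+ 2) ^+ 2 = 1 - x ^+ 2 - Y x ^+ 2 by rewrite sqr_sqrtr// ltW// N0.
  have rp := r0 _ h; rewrite -/(Y x); set r := Num.sqrt _ in rE rp *.
  have rn : r != 0 by rewrite gt_eqF.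
  have xn : 1 - x ^+ 2 != 0 by rewrite gt_eqF// x0.
  have tyE : t * Y x = 1 - e * x by rewrite /Y mulrC divfK.
  set m := t ^+ 2 + e ^+ 2 - 1.
  have mn : m != 0 by rewrite gt_eqF// /m; move: te; lra.
  (* [A] factors the denominator of the derivative of the arctangent. *)
  have A : t ^+ 2 * r ^+ 2 + (e - x) ^+ 2 = m * (1 - x ^+ 2).
    by rewrite rE mulrBr -exprMn tyE /m; ring.
  have -> : 1 + ((e - x) / (t * r)) ^+ 2 = m * (1 - x ^+ 2) / (t * r) ^+ 2.
    by rewrite -A; field; rewrite tn rn.
  (* [B] collapses the numerator of the derivative of the argument to a multiple of [Y x * m], whose
     factor [m] cancels against the one from [A]. *)
  have B : r ^+ 2 * t = (e - x) * (x * t - Y x * e) + Y x * m.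
    have exE : e * x = 1 - t * Y x by rewrite tyE; ring.
    by rewrite rE /m; ring: exE.
  move: B; rewrite -/(Y x); set y := Y x => B.
  by field: B; rewrite rn xn mn tn.
- apply: is_derive_continuous; rewrite /Y; derive_tac; rewrite -/(Y x) ?N0//.
  by rewrite mulf_neq0// gt_eqF// ?r0 ?x0.
Qed.

(** Splitting the columns at [c] gives two arctangents with reciprocal arguments, since c (e - c) =
    1 - c^2 - t^2. The value agrees with Gauss-Bonnet for five right angles. *)
Lemma harea_pentagon : harea (pentagon t e) = (pi / 2)%:E.
Proof.
have [c0 ce ceE ct] := cP; have [t0 t1] := andP t01; have [e0 e1] := andP e01.
rewrite (harea_xy (measurable_pentagon t e)).
pose g x := (\int[mu]_y hweight (pentagon t e) (x, y))%E.
have mg : measurable_fun [set: R] g.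
  by have := measurable_slice_integral (measurable_hweight (measurable_pentagon t e))
       (hweight_ge0 (pentagon t e)).
have g0 x : (0 <= g x)%E by apply: integral_ge0 => y _; exact: hweight_ge0.
transitivity (\int[mu]_(x in `[0%R, e]) g x)%E.
  rewrite [RHS]integral_mkcond; apply: eq_integral => x _.
  rewrite patchE mem_setb/= in_itv/=; case: ifPn => // xe.
  rewrite integral0_eq// => y _; rewrite /hweight patchE mem_setb/=.
  by case: ifPn => // /and5P[_ x1 x2 _ _]; rewrite x1 x2 in xe.
rewrite (@itv_bndbnd_setU _ _ _ (BRight c)) ?bnd_simp ?ltW//.
rewrite ge0_integral_setU//=; first last.
- apply/disj_setPLR => x/=; rewrite !in_itv/= => /andP[_ xc].
  by rewrite ltNge xc.
- exact: measurable_funTS.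
rewrite integral_itv_obnd_cbnd; last exact: measurable_funTS.
have -> : (\int[mu]_(x in `[0%R, c]) g x)%E = (atan (t * c / Num.sqrt (1 - c ^+ 2 - t ^+ 2)))%:E.
  rewrite -pentagon_low; apply: eq_integral => x; rewrite inE/= in_itv/= => /[dup] xc /andP[x0 x1].
  apply: pentagon_column; [lra|exact: disk_low|exact: ltW|].
  by move=> y y0; apply/idP/andP => [h|[]//]; split => //; nra.
have -> : (\int[mu]_(x in `[c, e]) g x)%E = (atan ((e - c) / (t * Num.sqrt (1 - c ^+ 2 - t ^+ 2))))%:E.
  rewrite -pentagon_high; apply: eq_integral => x; rewrite inE/= in_itv/= => /[dup] xc /andP[x0 x1].
  apply: pentagon_column; [lra|exact: disk_high| |].
    by rewrite /Y divr_ge0//; nra.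
  move=> y y0; rewrite /Y ler_pdivlMr//; apply/idP/andP => [h|[_ h]]; last lra.
  by split; nra.
rewrite -EFinD; congr EFin.
have r2 : Num.sqrt (1 - c ^+ 2 - t ^+ 2) ^+ 2 = 1 - c ^+ 2 - t ^+ 2 by rewrite sqr_sqrtr//; lra.
have rp : 0 < Num.sqrt (1 - c ^+ 2 - t ^+ 2) by rewrite sqrtr_gt0; lra.
set r := Num.sqrt _ in r2 rp *.
rewrite -(@atan_inv (t * c / r)); last by rewrite divr_gt0// mulr_gt0.
congr (_ + atan _); rewrite invf_div.
have -> : e - c = r ^+ 2 / c.
  have -> : r ^+ 2 = c * (e - c) by rewrite r2 mulrBr ceE; ring.
  by field; rewrite gt_eqF.
by field; rewrite !gt_eqF.
Qed.

End area.

End pentagon.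

(** * Distance from a point to a horizontal line *)

Section distance.
Context {R : realType}.

Lemma arcosh_le (x y : R) : 1 <= x -> 1 <= y -> (arcosh x <= arcosh y) = (x <= y).
Proof.
have pos z : 1 <= z -> 0 < z + Num.sqrt (z ^+ 2 - 1).
  by move=> z1; rewrite ltr_wpDr ?sqrtr_ge0//; lra.
have homo u v : 1 <= u -> u < v -> u + Num.sqrt (u ^+ 2 - 1) < v + Num.sqrt (v ^+ 2 - 1).
  move=> u1 uv; rewrite ltr_leD// ler_wsqrtr// lerB// ler_pXn2r ?nnegrE//; lra.
move=> x1 y1; rewrite /arcosh ler_ln ?posrE ?pos//.
have [xy|yx|->] := ltgtP x y; last by rewrite lexx.
- by rewrite ltW// homo.
- by apply/negbTE; rewrite -ltNge homo.
Qed.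

(* [sinh] squared of the distance from [p] to the line of ordinate [t] *)
Definition sinh2_dist (t : R) (p : R * R) : R :=
  (p.2 - t) ^+ 2 / ((1 - t ^+ 2) * (1 - p.1 ^+ 2 - p.2 ^+ 2)).

Lemma sinh2_dist_ge0 (t : R) p : -1 < t < 1 -> disk p -> 0 <= sinh2_dist t p.
Proof.
move=> t1; rewrite /disk/= => dp.
by rewrite divr_ge0 ?sqr_ge0// mulr_ge0; nra.
Qed.

(** The squares of the two sides, both hyperbolic cosines, differ by a perfect square over a
    positive quantity; the square vanishes exactly at the foot of the perpendicular. *)
Lemma hdist_horizontal (t q : R) p : -1 < t < 1 -> disk p -> disk (q, t) ->
  Num.sqrt (1 + sinh2_dist t p) <=
    (1 - p.1 * q - p.2 * t) / Num.sqrt ((1 - p.1 ^+ 2 - p.2 ^+ 2) * (1 - q ^+ 2 - t ^+ 2))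
    ?= iff (q * (1 - p.2 * t) == p.1 * (1 - t ^+ 2)).
Proof.
move: p => [x y]; rewrite /disk/= => t1 dp dq.
have s0 : 0 < 1 - t ^+ 2 by nra.
have N0 : 0 < 1 - x ^+ 2 - y ^+ 2 by lra.
have Q0 : 0 < 1 - q ^+ 2 - t ^+ 2 by lra.
have v0 : 0 < 1 - x * q - y * t.
  by have := sqr_ge0 (x - q); have := sqr_ge0 (y - t); lra.
have w0 : 0 < (1 - x ^+ 2 - y ^+ 2) * (1 - q ^+ 2 - t ^+ 2) by rewrite mulr_gt0.
set v := 1 - x * q - y * t in v0 *; set w := _ * _ in w0 *.
have rw : 0 < Num.sqrt w by rewrite sqrtr_gt0.
have rho0 : 0 <= 1 + sinh2_dist t (x, y) by rewrite addr_ge0 ?sinh2_dist_ge0.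
have E : v ^+ 2 / w - (1 + sinh2_dist t (x, y)) =
    (q * (1 - y * t) - x * (1 - t ^+ 2)) ^+ 2 / ((1 - t ^+ 2) * w).
  by rewrite /v /w /sinh2_dist/=; field; rewrite !gt_eqF.
have vw : v / Num.sqrt w = Num.sqrt (v ^+ 2 / w).
  by rewrite [RHS]sqrtrM ?sqr_ge0// sqrtr_sqr gtr0_norm// sqrtrV// ltW.
have sw : 0 < (1 - t ^+ 2) * w by rewrite mulr_gt0.
rewrite vw; split.
  by rewrite ler_wsqrtr// -subr_ge0 E divr_ge0 ?sqr_ge0// ltW.
have vw0 : 0 <= v ^+ 2 / w by rewrite divr_ge0 ?sqr_ge0// ltW.
rewrite eqr_sqrt//.
rewrite eq_sym -subr_eq0 E mulf_eq0 invr_eq0 [_ * w == 0]gt_eqF// orbF.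
by rewrite expf_eq0/= subr_eq0.
Qed.

Lemma hdist_line_horizontal (w : hvec R) (t : R) p : -1 < t < 1 -> disk p ->
  (forall q, lorentz w (Defs.hom q) = 0 <-> q.2 = t) ->
  hdist_line p w = arcosh (Num.sqrt (1 + sinh2_dist t p)).
Proof.
move=> t1 dp wP.
have rho1 : 1 <= Num.sqrt (1 + sinh2_dist t p).
  by rewrite -{1}sqrtr1 ler_wsqrtr// lerDl sinh2_dist_ge0.
have lbE : lbound [set hdist p q | q in hline w] (arcosh (Num.sqrt (1 + sinh2_dist t p))).
  move=> _ [[q t'] [dq /wP/= tE] <-]; subst t'.
  have := (hdist_horizontal t1 dp dq).1 => h.
  by rewrite /hdist/= arcosh_le//; apply: le_trans h.
have [t2 t3] := andP t1.
have s0 : 0 < 1 - t ^+ 2 by nra.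
have p2 : 0 < 1 - p.2 * t.
  have := sqr_ge0 (p.2 - t); have := sqr_ge0 p.1; move: dp; rewrite /disk/=; lra.
(* The foot of the perpendicular, read off from the equality case; the identity below shows that it
   lies in the disk, so the infimum is attained. *)
pose q := p.1 * (1 - t ^+ 2) / (1 - p.2 * t).
have dq : disk (q, t).
  rewrite /disk/= -subr_gt0 -(pmulr_rgt0 _ (exprn_gt0 2 p2)).
  have -> : (1 - p.2 * t) ^+ 2 * (1 - (q ^+ 2 + t ^+ 2)) =
      (1 - t ^+ 2) * ((1 - t ^+ 2) * (1 - p.1 ^+ 2 - p.2 ^+ 2) + (p.2 - t) ^+ 2).
    by rewrite /q; field; rewrite gt_eqF.
  rewrite mulr_gt0// ltr_wpDr ?sqr_ge0// mulr_gt0//; move: dp; rewrite /disk/=; lra.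
have Eq : [set hdist p q | q in hline w] (arcosh (Num.sqrt (1 + sinh2_dist t p))).
  exists (q, t); first by split => //; exact/wP.
  rewrite /hdist/=; congr arcosh; apply/esym/eqP.
  by rewrite (hdist_horizontal t1 dp dq).2 /q divfK// gt_eqF.
apply/eqP; rewrite eq_le; apply/andP; split.
- by apply: ge_inf => //; exists (arcosh (Num.sqrt (1 + sinh2_dist t p))).
- by apply: lb_le_inf => //; exists (arcosh (Num.sqrt (1 + sinh2_dist t p))).
Qed.

(** Removes the infimum and [arcosh]: membership under a hypercycle becomes an algebraic
    inequality. *)
Lemma hdist_line_le (w : hvec R) (t : R) p q : -1 < t < 1 -> disk p -> disk q ->
  (forall q, lorentz w (Defs.hom q) = 0 <-> q.2 = t) ->
  (hdist_line p w <= hdist_line q w) = (sinh2_dist t p <= sinh2_dist t q).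
Proof.
move=> t1 dp dq wP.
have r1 z : disk z -> 1 <= Num.sqrt (1 + sinh2_dist t z).
  by move=> dz; rewrite -{1}sqrtr1 ler_wsqrtr// lerDl sinh2_dist_ge0.
rewrite !(@hdist_line_horizontal w t)// arcosh_le ?r1// ler_sqrt ?lerD2l//.
by rewrite addr_ge0// sinh2_dist_ge0.
Qed.

End distance.

(** * The regions and the density for a fixed admissible pair *)

Section regions.
Context {R : realType}.

(** Only the sign of the product matters, so a positive factor [k] can be stripped, leaving a
    normalised affine inequality. *)
Lemma half_planeE (w q : hvec R) (k : R) (f : R * R -> R) : 0 < k ->
  (forall p, lorentz w (Defs.hom p) * lorentz w q = k * f p) ->
  half_plane w q = [set p | disk p /\ 0 <= f p].
Proof.
move=> k0 wq; apply/seteqP; split => p; rewrite /half_plane/= wq pmulr_rge0//.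
Qed.

Section fixed_ab.
Variables a b : R.
Hypothesis ab : admissible a b.
Let t := a^-1.
Let e := b^-1.

Lemma admissible_inv : [/\ 0 < t < 1, 0 < e < 1 & 1 < t ^+ 2 + e ^+ 2].
Proof.
have [a1 b1 h] := ab; split; last by rewrite !exprVn.
- by rewrite invr_gt0 invf_lt1; lra.
- by rewrite invr_gt0 invf_lt1; lra.
Qed.

Let a0 : 0 < a. Proof. by have [] := ab; lra. Qed.
Let b0 : 0 < b. Proof. by have [] := ab; lra. Qed.

Lemma truncated_orthoschemeE : truncated_orthoscheme a b = pentagon t e.
Proof.
have an := lt0r_neq0 a0; have bn := lt0r_neq0 b0.
rewrite /truncated_orthoscheme.
rewrite (@half_planeE _ _ (a ^+ 2 * b) (fun p => p.1)); first last.
- by move=> p; rewrite /lorentz/=; ring.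
- by rewrite mulr_gt0// exprn_gt0.
rewrite (@half_planeE _ _ (a * b ^+ 2) (fun p => p.2)); first last.
- by move=> p; rewrite /lorentz/=; ring.
- by rewrite mulr_gt0// exprn_gt0.
rewrite (@half_planeE _ _ (a ^+ 2 * b ^+ 2) (fun p => 1 - (e * p.1 + t * p.2))); first last.
- by move=> p; rewrite /lorentz/= /e /t; field; rewrite an bn.
- by rewrite mulr_gt0// exprn_gt0.
rewrite (@half_planeE _ _ a (fun p => t - p.2))//; last first.
  by move=> p; rewrite /lorentz/= /t; field.
rewrite (@half_planeE _ _ b (fun p => e - p.1))//; last first.
  by move=> p; rewrite /lorentz/= /e; field.
apply/seteqP; split => p; rewrite /pentagon /disk/= !subr_ge0.
- by move=> [[[[[-> ->] [_ ->]] [_ ->]] [_ ->]] [_ ->]].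
- by case/and5P => -> -> -> -> /andP[-> ->].
Qed.

Let c := b * (1 - t ^+ 2).
Let J := ptJ a b.

Lemma ptJ_E : J = ((c + e) / 2, (t + a * (1 - e ^+ 2)) / 2).
Proof.
have [a1 b1 _] := ab.
by rewrite /J /ptJ ptCE// ptDE//= /c /t /e !exprVn.
Qed.

(** Since t = a t^2, the upper bound is the admissibility inequality 1 - e^2 < t^2. The same
    argument with the roles exchanged places C. *)
Lemma ptD_below : 0 < a * (1 - e ^+ 2) < t.
Proof.
have [t1 /andP[e0 e1] te] := admissible_inv; have ta : t * a = 1 by rewrite /t mulVf// lt0r_neq0.
rewrite mulr_gt0//=; last by rewrite subr_gt0 exprn_ilt1// ltW.
have tE : t = a * t ^+ 2 by rewrite expr2 mulrA [a * t]mulrC ta mul1r.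
rewrite [ltRHS]tE ltr_pM2l//; lra.
Qed.

Lemma ptC_right : 0 < c < e.
Proof.
have [/andP[t0 t1] e1 te] := admissible_inv; have eb : e * b = 1 by rewrite /e mulVf// lt0r_neq0.
rewrite /c mulr_gt0//=; last by rewrite subr_gt0 exprn_ilt1// ltW.
have eE : e = b * e ^+ 2 by rewrite expr2 mulrA [b * e]mulrC eb mul1r.
rewrite [ltRHS]eE ltr_pM2l//; lra.
Qed.

(** For C = (c, t) and D = (e, d), the relations ce = 1 - t^2 and dt = 1 - e^2 give 4 (1 - x^2 -
    y^2) = (e^2 - c^2) + (t^2 - d^2) at J, a sum of positive terms. *)
Lemma ptJ_disk : disk J.
Proof.
have [t01 e01 te] := admissible_inv.
have ta : t * a = 1 by rewrite /t mulVf// lt0r_neq0.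
have eb : e * b = 1 by rewrite /e mulVf// lt0r_neq0.
have := ptD_below; have := ptC_right; rewrite /disk ptJ_E/=.
set d := a * (1 - e ^+ 2) => cP dP.
have ce : c * e = 1 - t ^+ 2 by rewrite /c mulrAC [b * e]mulrC eb mul1r.
have dt : d * t = 1 - e ^+ 2 by rewrite /d mulrAC [a * t]mulrC ta mul1r.
nra.
Qed.

Lemma ptJ_height : 0 < J.2 < t.
Proof. by have := ptD_below; have [/andP[]] := admissible_inv; rewrite ptJ_E/=; lra. Qed.

(** The mirror image in y = 0 is the pencil region over the chord y = 0 with u0 = e and M = sinh
    h1. *)
Lemma harea_region1 :
  harea (region1 a b) = (Num.sqrt (sinh2_dist 0 J) * artanh e)%:E.
Proof.
have [t01 /andP[e0 e1] te] := admissible_inv; have [a1 b1 _] := ab.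
have Jd := ptJ_disk; have [J0 _] := andP ptJ_height.
set M := Num.sqrt _.
have rho0 : 0 < sinh2_dist 0 J.
  rewrite divr_gt0 ?exprn_gt0 ?subr0//; move: Jd; rewrite /disk/= => Jd.
  by rewrite expr0n/= subr0 mul1r; lra.
have M0 : 0 < M by rewrite sqrtr_gt0.
have ME : M ^+ 2 = sinh2_dist 0 J by rewrite sqr_sqrtr// ltW.
suff -> : region1 a b = [set p | pencil_region 0 e M (p.1, - p.2)].
  rewrite (harea_reflect (measurable_pencil_region 0 e M)) harea_pencil//; last 3 first.
  - by rewrite lexx ltr01.
  - exact: ltW.
  - by rewrite expr0n/= subr0 mulr1 exprn_ilt1// ltW.
  by rewrite expr0n/= subr0 sqrtr1 divr1 mulr1.
have D0 : 0 < (ptD a b).2 by rewrite ptDE//= -exprVn; have /andP[] := ptD_below.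
rewrite /region1 ptEE// -/e /hypercycle_region; cbv zeta.
set w := lcross _ (Defs.hom (e, 0)).
have wP (p : R * R) : lorentz w (Defs.hom p) = 0 <-> p.2 = 0.
  have -> : lorentz w (Defs.hom p) = e * p.2 by rewrite /lorentz /w/=; ring.
  split => [/eqP|->]; last by rewrite mulr0.
  by rewrite mulf_eq0 gt_eqF//= => /eqP.
rewrite (@half_planeE _ _ (e ^+ 3) (fun p => p.1)); first last.
- by move=> p; rewrite /lorentz /w/=; ring.
- by rewrite exprn_gt0.
rewrite (@half_planeE _ _ (e ^+ 3) (fun p => e - p.1)); first last.
- by move=> p; rewrite /lorentz /w/=; ring.
- by rewrite exprn_gt0.
rewrite (@half_planeE _ _ (e ^+ 2 * (ptD a b).2) (fun p => p.2)); first last.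
- by move=> p; rewrite /lorentz /w/=; ring.
- by rewrite mulr_gt0// exprn_gt0.
have memE p : disk p -> (hdist_line p w <= height1 a b) = (p.2 ^+ 2 <= M ^+ 2 * (1 - p.1 ^+ 2 - p.2 ^+ 2)).
  move=> dp; rewrite /height1 ptEE// -/e -/w (@hdist_line_le _ _ 0)//; last by rewrite ltrN10 ltr01.
  rewrite ME {1}/sinh2_dist expr0n/= !subr0 mul1r ler_pdivrMr//.
  by move: dp; rewrite /disk/=; lra.
apply/seteqP; split => p; rewrite /pencil_region/= sqrrN.
- move=> [[[[dp x0] [_ x1]] [_ y0]]]; rewrite memE// => h.
  rewrite dp x0 mul0r subr0 mulr1 oppr_le0 y0 sub0r opprK h andbT/=; lra.
- rewrite mul0r subr0 mulr1 oppr_le0 sub0r opprK => /and5P[dp x0 x1 y0 h].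
  by split; [repeat split => //; lra|rewrite memE].
Qed.

(** The perpendicular to FC at C is the line AB itself, x = b (1 - t y), so the region is a pencil
    region with u0 = b. *)
Lemma harea_region2 :
  harea (region2 a b) =
    (Num.sqrt (sinh2_dist t J) * artanh (b * Num.sqrt (1 - t ^+ 2)))%:E.
Proof.
have [/andP[t0 t1] /andP[e0 e1] te] := admissible_inv; have [a1 b1 _] := ab.
have eb : e * b = 1 by rewrite /e mulVf// lt0r_neq0.
have Jd := ptJ_disk; have [_ J1] := andP ptJ_height.
have s0 : 0 < 1 - t ^+ 2 by rewrite subr_gt0 exprn_ilt1// ltW.
have sp : 0 < Num.sqrt (1 - t ^+ 2) by rewrite sqrtr_gt0.
set M := Num.sqrt (sinh2_dist t J).
have rho0 : 0 < sinh2_dist t J.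
  rewrite divr_gt0//; last by rewrite mulr_gt0//; move: Jd; rewrite /disk/=; lra.
  by rewrite exprn_even_gt0//= subr_eq0 lt_eqF.
have M0 : 0 < M by rewrite sqrtr_gt0.
have ME : M ^+ 2 = sinh2_dist t J by rewrite sqr_sqrtr// ltW.
have [/andP[c0 ce]] := (ptC_right).
suff -> : region2 a b = pencil_region t b (M * Num.sqrt (1 - t ^+ 2)).
  rewrite harea_pencil ?mulr_gt0 ?mulfK ?gt_eqF//; first by rewrite t1 ltW.
  - exact: ltW.
  (* Multiplied by e^2, the bound b^2 (1 - t^2) < 1 becomes the admissibility inequality. *)
  - rewrite -(@ltr_pM2l _ (e ^+ 2)) ?exprn_gt0// mulrA -exprMn eb expr1n mul1r mulr1; lra.
rewrite /region2 ptFE// ptCE// -exprVn -/t -/c /hypercycle_region; cbv zeta.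
have D0 : (ptD a b).2 < t by rewrite ptDE//= -exprVn; have /andP[] := ptD_below.
set w := lcross (Defs.hom (0, t)) (Defs.hom (c, t)).
have wP (p : R * R) : lorentz w (Defs.hom p) = 0 <-> p.2 = t.
  have -> : lorentz w (Defs.hom p) = c * (p.2 - t) by rewrite /lorentz /w/=; ring.
  split => [/eqP|->]; last by rewrite subrr mulr0.
  by rewrite mulf_eq0 gt_eqF//= subr_eq0 => /eqP.
rewrite (@half_planeE _ _ (c ^+ 3 * (1 - t ^+ 2) ^+ 2) (fun p => p.1)); first last.
- by move=> p; rewrite /lorentz /w/=; ring.
- by rewrite mulr_gt0// exprn_gt0.
rewrite (@half_planeE _ _ (c ^+ 3 * (1 - t ^+ 2) ^+ 2) (fun p => b * (1 - t * p.2) - p.1)); first last.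
- by move=> p; rewrite /lorentz /w/= /c; ring.
- by rewrite mulr_gt0// exprn_gt0.
rewrite (@half_planeE _ _ (c ^+ 2 * (t - (ptD a b).2)) (fun p => t - p.2)); first last.
- by move=> p; rewrite /lorentz /w/=; ring.
- by rewrite mulr_gt0// ?exprn_gt0// subr_gt0.
have memE p : disk p -> (hdist_line p w <= height2 a b) =
    ((t - p.2) ^+ 2 <= (M * Num.sqrt (1 - t ^+ 2)) ^+ 2 * (1 - p.1 ^+ 2 - p.2 ^+ 2)).
  move=> dp; rewrite /height2 ptFE// ptCE// -exprVn -/t -/c -/w (@hdist_line_le _ _ t)//; last lra.
  rewrite exprMn ME sqr_sqrtr ?(ltW s0)// -mulrA {1}/sinh2_dist ler_pdivrMr -?[t - p.2]opprB ?sqrrN//.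
  by rewrite mulr_gt0//; move: dp; rewrite /disk/=; lra.
apply/seteqP; split => p; rewrite /pencil_region/=.
- move=> [[[[dp x0] [_ x1]] [_ y0]]]; rewrite memE// => h.
  by rewrite dp x0 h andbT/= -subr_ge0 x1 -subr_ge0 y0.
- move=> /and5P[dp x0 x1 y0 h].
  by split; [repeat split => //; rewrite subr_ge0|rewrite memE].
Qed.

Lemma density_admissible : density a b =
  (Num.sqrt (sinh2_dist 0 J) * artanh e +
   Num.sqrt (sinh2_dist t J) * artanh (b * Num.sqrt (1 - t ^+ 2))) / (pi / 2).
Proof.
have [t01 e01 te] := admissible_inv.
by rewrite /density harea_region1 harea_region2 truncated_orthoschemeE harea_pentagon.
Qed.

End fixed_ab.
End regions.

(** * The limits a to 1 and then b to infinity *)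

Section limits.
Context {R : realType}.

(** By [artanh_bounds] the quotient is squeezed between 1/(1 + z) and 1/(1 - z). *)
Lemma cvg_artanh_ratio (T : Type) (F : set_system T) (z : T -> R) : Filter F ->
  z x @[x --> F] --> (0 : R) -> (\forall x \near F, 0 < z x < 1) ->
  artanh (z x) / z x @[x --> F] --> (1 : R).
Proof.
move=> FF z0 z01.
have c (k : R) : (1 + k * z x)^-1 @[x --> F] --> (1 : R).
  have h : {for 0, continuous (fun y : R => (1 + k * y)^-1)}.
    by apply: is_derive_continuous; derive_tac; rewrite mulr0 addr0 oner_eq0.
  have := @continuous_cvg _ _ _ F _ z _ _ h z0; rewrite mulr0 addr0 invr1; exact.
apply: squeeze_cvgr (c 1) (c (-1)).
near=> x.
have zx : 0 < z x < 1 by near: x.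
have /andP[h1 h2] := artanh_bounds zx; have [zp z1] := andP zx.
rewrite mul1r mulN1r; apply/andP; split.
- by rewrite ler_pdivlMr// mulrC.
- by rewrite ler_pdivrMr// mulrC.
Unshelve. all: by end_near. Qed.

Section fixed_b.
Variable b : R.
Hypothesis b1 : 1 < b.
Let e := b^-1.

Let b0 : 0 < b. Proof. exact: lt_trans ltr01 b1. Qed.

Let e_itv : 0 < e < 1.
Proof. by rewrite invr_gt0 b0 invf_lt1. Qed.

(** The coordinates of J for fixed b, which make sense at a = 1 as well; [z a] is the hyperbolic
    tangent of the length of FC. *)
Let xJ (a : R) := (b * (1 - a^-1 ^+ 2) + e) / 2.
Let yJ (a : R) := (a^-1 + a * (1 - e ^+ 2)) / 2.
Let rJ (a : R) := Num.sqrt (1 - xJ a ^+ 2 - yJ a ^+ 2).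
Let z (a : R) := b * Num.sqrt (1 - a^-1 ^+ 2).

(** The factor 1/s in sinh h2 equals b / [z a] and is absorbed into artanh z / z. The remaining
    factors are continuous at a = 1. *)
Lemma density_split a : admissible a b ->
  density a b = (yJ a / rJ a * artanh e + (a^-1 - yJ a) / rJ a * b * (artanh (z a) / z a)) / (pi / 2).
Proof.
move=> ab; rewrite (density_admissible ab).
have [t01 e01 te] := admissible_inv ab.
have Jd := ptJ_disk ab; have := ptJ_height ab; move: Jd; rewrite (ptJ_E ab) /disk/=.
rewrite -/e -/(xJ a) -/(yJ a) => Jd /andP[yJ0 yJt].
have N0 : 0 < 1 - xJ a ^+ 2 - yJ a ^+ 2 by lra.
have r0 : 0 < rJ a by rewrite sqrtr_gt0.
have s0 : 0 < 1 - a^-1 ^+ 2 by rewrite subr_gt0 exprn_ilt1//; case/andP: t01 => // /ltW.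
have sp : 0 < Num.sqrt (1 - a^-1 ^+ 2) by rewrite sqrtr_gt0.
have -> : Num.sqrt (sinh2_dist 0 (xJ a, yJ a)) = yJ a / rJ a.
  rewrite /sinh2_dist/= expr0n/= !subr0 mul1r sqrtrM ?sqr_ge0// sqrtr_sqr gtr0_norm//.
  by rewrite sqrtrV// ltW.
have -> : Num.sqrt (sinh2_dist a^-1 (xJ a, yJ a)) =
    (a^-1 - yJ a) / (Num.sqrt (1 - a^-1 ^+ 2) * rJ a).
  rewrite /sinh2_dist/= sqrtrM ?sqr_ge0// sqrtr_sqr ltr0_norm ?subr_lt0// opprB.
  by rewrite sqrtrV ?mulr_ge0 ?ltW// sqrtrM// ltW.
have bn : b != 0 by rewrite gt_eqF.
rewrite /z; set s := Num.sqrt (1 - _) in sp *; set A := artanh _; set B := artanh _.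
congr (_ / _); congr (_ + _).
have an : a != 0 by have [h _ _] := ab; rewrite gt_eqF// (lt_trans ltr01).
by field; rewrite bn an !gt_eqF.
Qed.

Definition density_lim1 : R :=
  (yJ 1 / rJ 1 * artanh e + (1 - yJ 1) / rJ 1 * b) / (pi / 2).

(** At a = 1 the point J is (e/2, 1 - e^2/2), still inside the disk, so dividing by [rJ] is harmless
    in the limit. *)
Lemma rJ1 : rJ 1 = e * Num.sqrt (3 - e ^+ 2) / 2.
Proof.
have [e0 e1] := andP e_itv.
have -> : rJ 1 = Num.sqrt ((e / 2) ^+ 2 * (3 - e ^+ 2)).
  by congr Num.sqrt; rewrite /xJ /yJ invr1 expr1n; field.
rewrite sqrtrM ?sqr_ge0// sqrtr_sqr gtr0_norm ?divr_gt0//; ring.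
Qed.

Lemma density_cvg_at1 :
  density a b @[a --> within [set a | admissible a b] (nbhs (1 : R))] --> density_lim1.
Proof.
have [e0 e1] := andP e_itv.
have N1 : 0 < 1 - xJ 1 ^+ 2 - yJ 1 ^+ 2.
  by rewrite -sqrtr_gt0 -/(rJ 1) rJ1 divr_gt0// mulr_gt0// sqrtr_gt0; nra.
have r1 : 0 < rJ 1 by rewrite sqrtr_gt0.
set F := within _ _.
have c1 : yJ a / rJ a @[a --> F] --> (yJ 1 / rJ 1 : R).
  apply: cvg_within_filter; suff : {for 1, continuous (fun a => yJ a / rJ a)} by [].
  apply: is_derive_continuous; rewrite /yJ /rJ /xJ /yJ; derive_tac;
    first [exact: oner_neq0 | exact: lt0r_neq0 r1 | exact: N1].
have c2 : (fun a : R => (a^-1 - yJ a) / rJ a) @ F --> ((1^-1 - yJ 1) / rJ 1 : R).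
  apply: cvg_within_filter; suff : {for 1, continuous (fun a : R => (a^-1 - yJ a) / rJ a)} by [].
  apply: is_derive_continuous; rewrite /yJ /rJ /xJ /yJ; derive_tac;
    first [exact: oner_neq0 | exact: lt0r_neq0 r1 | exact: N1].
have c3 : artanh (z a) / z a @[a --> F] --> (1 : R).
  apply: cvg_artanh_ratio.
  - have -> : 0 = b * Num.sqrt (1 - 1^-1 ^+ 2) by rewrite invr1 expr1n subrr sqrtr0 mulr0.
    apply: cvgMr; apply: continuous_cvg; first exact: sqrt_continuous.
    apply: cvg_within_filter; suff : {for 1, continuous (fun a : R => 1 - a^-1 ^+ 2)} by [].
    by apply: is_derive_continuous; derive_tac; rewrite oner_eq0.
  (* Admissibility gives 1 - t^2 < e^2, which is z < 1 after taking roots and multiplying by b. *)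
  - rewrite /F near_withinE; near=> a => ab.
    have [/andP[t0 t1] _ te] := admissible_inv ab.
    have s0 : 0 < 1 - a^-1 ^+ 2 by rewrite subr_gt0 exprn_ilt1// ltW.
    rewrite /z mulr_gt0 ?sqrtr_gt0//= -(@ltr_pM2l _ e)// mulrA mulVf ?gt_eqF// mul1r mulr1.
    rewrite -(@ltr_pXn2r _ 2) ?nnegrE ?sqrtr_ge0 ?(ltW e0)// sqr_sqrtr ?(ltW s0)//.
    by rewrite /e; lra.
rewrite invr1 in c2; rewrite /density_lim1 -[(1 - yJ 1) / rJ 1 * b]mulr1.
apply: (@cvg_trans _ ((fun a => (yJ a / rJ a * artanh e + (a^-1 - yJ a) / rJ a * b * (artanh (z a) / z a)) / (pi / 2)) @ F)).
  apply: near_eq_cvg; rewrite /F near_withinE; near=> a => ab.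
  by rewrite (density_split ab).
apply: cvgMl; apply: cvgD; first exact: cvgMl.
by apply: cvgM => //; exact: cvgMl.
Unshelve. all: by end_near. Qed.

(** Pairing artanh e with 1/e makes the behaviour as e tends to 0 visible. *)
Lemma density_lim1E : density_lim1 =
  (2 * (1 - e ^+ 2 / 2) * (artanh e / e) + 1) / Num.sqrt (3 - e ^+ 2) / (pi / 2).
Proof.
have [e0 e1] := andP e_itv.
have r0 : 0 < Num.sqrt (3 - e ^+ 2) by rewrite sqrtr_gt0; nra.
have be : b = e^-1 by rewrite /e invrK.
have -> : density_lim1 = (yJ 1 / rJ 1 * artanh e + (1 - yJ 1) / rJ 1 * e^-1) / (pi / 2).
  by rewrite /density_lim1 {1}be.
congr (_ / _); rewrite rJ1 /yJ invr1 mul1r; set r := Num.sqrt _ in r0 *; set A := artanh e.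
by field; rewrite !gt_eqF.
Qed.

End fixed_b.

Lemma density_lim1_cvgy : density_lim1 b @[b --> +oo] --> (Num.sqrt 12 / pi : R).
Proof.
have cV : (fun b : R => b^-1) @ +oo --> (0 : R).
  apply/gtr0_cvgV0; last exact: cvg_id.
  exact: nbhs_pinfty_gt.
have c1 : (fun b : R => artanh b^-1 / b^-1) @ +oo --> (1 : R).
  apply: cvg_artanh_ratio => //; near=> b.
  have b1 : 1 < b by near: b; exact: nbhs_pinfty_gt.
  by rewrite invr_gt0 (lt_trans ltr01 b1) invf_lt1// (lt_trans ltr01 b1).
have c2 : (fun b : R => 2 * (1 - b^-1 ^+ 2 / 2)) @ +oo --> (2 : R).
  have h : {for 0, continuous (fun e : R => 2 * (1 - e ^+ 2 / 2))}.
    by apply: is_derive_continuous; derive_tac.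
  have := continuous_cvg _ h cV; rewrite expr0n/= mul0r subr0 mulr1; exact.
have c3 : (fun b : R => (Num.sqrt (3 - b^-1 ^+ 2))^-1) @ +oo --> ((Num.sqrt 3)^-1 : R).
  have h : {for 0, continuous (fun e : R => (Num.sqrt (3 - e ^+ 2))^-1)}.
    apply: is_derive_continuous; derive_tac; rewrite expr0n/= subr0 ?gt_eqF ?sqrtr_gt0//.
  have := continuous_cvg _ h cV; rewrite expr0n/= subr0; exact.
(* At e = 0 the limit is 3 / sqrt 3 divided by pi / 2, that is 2 sqrt 3 / pi. *)
have -> : Num.sqrt 12 / pi = (2 * 1 + 1) / Num.sqrt 3 / (pi / 2) :> R.
  have -> : 12 = 2 ^+ 2 * 3 :> R by ring.
  rewrite sqrtrM ?sqr_ge0// sqrtr_sqr ger0_norm//.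
  have r3 : Num.sqrt 3 ^+ 2 = 3 :> R by rewrite sqr_sqrtr.
  have r0 : 0 < Num.sqrt 3 :> R by rewrite sqrtr_gt0.
  have p0 := @pi_gt0 R.
  set r := Num.sqrt 3 in r3 r0 *.
  have -> : 2 * 1 + 1 = r ^+ 2 by rewrite r3; ring.
  by move: (pi : R) p0 => p p0; field; rewrite !gt_eqF.
have c4 : (fun b : R => (2 * (1 - b^-1 ^+ 2 / 2) * (artanh b^-1 / b^-1) + 1)
    / Num.sqrt (3 - b^-1 ^+ 2) / (pi / 2)) @ +oo --> ((2 * 1 + 1) / Num.sqrt 3 / (pi / 2) : R).
  apply: cvgMl; apply: cvgM => //; apply: cvgD; last exact: cvg_cst.
  exact: cvgM.
apply: cvg_trans _ c4; apply: near_eq_cvg; near=> b.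
by rewrite density_lim1E//; near: b; exact: nbhs_pinfty_gt.
Unshelve. all: by end_near. Qed.

End limits.

Theorem theorem4p1 (R : realType) :
  exists g : R -> R,
    (forall b : R, 1 < b ->
       density a b @[a --> within [set a | admissible a b] (nbhs (1 : R))]
         --> g b)
    /\ g b @[b --> +oo] --> Num.sqrt 12 / pi.
Proof.
exists density_lim1; split; last exact: density_lim1_cvgy.
by move=> b b1; exact: density_cvg_at1.
Qed.
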